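(* Let $\mathscr Q_n$ be a non-singular quadric in $\mathrm{PG}(n,2)$ of projective index $g\geq1$, and for $0\le s<g$ let $\Gamma_s$ be the graph constructed from an $s$-dimensional subspace $\alpha_s$ contained in $\mathscr Q_n$ as described below. Then the graphs $\Gamma_0,\Gamma_1,\ldots,\Gamma_{g-1}$ are pairwise non-isomorphic.
   Context: A non-singular quadric $\mathscr Q_n$ in $\mathrm{PG}(n,2)$ is the point set of a non-degenerate quadric; its projective index $g$ is the largest dimension of a projective subspace contained in $\mathscr Q_n$. The point-graph $\Gamma$ has vertex set the points of $\mathscr Q_n$, two distinct points adjacent iff the line joining them is contained in $\mathscr Q_n$. For $0\le s<g$ and an $s$-dimensional subspace $\alpha_s\subseteq\mathscr Q_n$: a point $X$ of $\mathscr Q_n$ has type (i) if $X\in\alpha_s$; type (ii) if $X\notin\alpha_s$ and $\langle\alpha_s,X\rangle\subseteq\mathscr Q_n$; type (iii) otherwise. Let $\mathcal X_s$ be the type (ii) points and $\mathcal Y_s$ the points of type (i) or (iii). The graph $\Gamma_s$ has the same vertex set as $\Gamma$ and the same edges, except that for each vertex $R\in\mathcal Y_s$ having exactly $\frac12|\mathcal X_s|$ neighbours in $\mathcal X_s$ (in $\Gamma$), those edges are deleted and $R$ is joined instead to the other $\frac12|\mathcal X_s|$ vertices of $\mathcal X_s$. *)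

(* Defs.v *)
From mathcomp Require Import all_boot all_order all_algebra.
Set Implicit Arguments. Unset Strict Implicit. Unset Printing Implicit Defensive.
Import GRing.Theory.
Local Open Scope ring_scope.

(* Vectors of F_2^(n+1); nonzero vectors = points of PG(n,2). *)
Notation vec n := 'rV['F_2]_(n.+1).

(* The quadratic form q(x) = x A x^T (every quadratic form over F_2 arises so). *)
Definition qf n (A : 'M['F_2]_(n.+1)) (x : vec n) : 'F_2 := (x *m A *m x^T) 0 0.

Definition qb n (A : 'M['F_2]_(n.+1)) (x y : vec n) : 'F_2 :=
  qf A (x + y) - qf A x - qf A y.

(* Non-singular quadric: no singular point (no nonzero v with q(v)=0 in the
   radical of the polar form), i.e. the quadric is not a cone. *)
Definition nonsingular n (A : 'M['F_2]_(n.+1)) : Prop :=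
  forall v : vec n, qf A v = 0 -> (forall w, qb A v w = 0) -> v = 0.

(* A projective subspace, given as the row space of U (projective dimension
   \rank U - 1), is contained in the quadric. *)
Definition tsing n (A : 'M['F_2]_(n.+1)) (U : 'M['F_2]_(n.+1)) : Prop :=
  forall v : vec n, (v <= U)%MS -> qf A v = 0.

Definition proj_index n (A : 'M['F_2]_(n.+1)) (g : nat) : Prop :=
  (exists U, \rank U = g.+1 /\ tsing A U) /\
  (forall U, tsing A U -> (\rank U <= g.+1)%N).

Definition Qpts n (A : 'M['F_2]_(n.+1)) : {set vec n} :=
  [set v : vec n | (v != 0) && (qf A v == 0)].

(* Collinearity graph Gamma: distinct points joined iff the line
   {x, y, x+y} lies on the quadric. *)
Definition adj n (A : 'M['F_2]_(n.+1)) (x y : vec n) : bool :=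
  [&& x \in Qpts A, y \in Qpts A, x != y & qf A (x + y) == 0].

Definition Xs n (A U : 'M['F_2]_(n.+1)) : {set vec n} :=
  [set x in Qpts A | ~~ (x <= U)%MS &&
     [forall v : vec n, (v <= U + x)%MS ==> (qf A v == 0)]].

Definition Ys n (A U : 'M['F_2]_(n.+1)) : {set vec n} := Qpts A :\: Xs A U.

Definition switched n (A U : 'M['F_2]_(n.+1)) (r : vec n) : bool :=
  (r \in Ys A U) &&
  ((2 * #|[set x in Xs A U | adj A r x]|)%N == #|Xs A U|).

Definition adjS n (A U : 'M['F_2]_(n.+1)) (x y : vec n) : bool :=
  if (x \in Xs A U) && (y \in Ys A U) then
    (if switched A U y then ~~ adj A x y else adj A x y)
  else if (y \in Xs A U) && (x \in Ys A U) then
    (if switched A U x then ~~ adj A x y else adj A x y)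
  else adj A x y.

Definition graph_iso (T : finType) (P : {set T}) (e1 e2 : rel T) : Prop :=
  exists f : T -> T, [/\ {in P &, injective f}, f @: P = P &
    {in P &, forall x y, e1 x y = e2 (f x) (f y)}].

(* Main.v *)
(** Call three mutually adjacent vertices of a graph a good triple if every
    vertex is equal or adjacent to an odd number of them, and let [d(z)] be the
    number of vertices lying in a good triple with [z].  Put k = s + 1, the
    vector space dimension of alpha_s.

    Every type (iii) point is switched and no type (i) point is, so in Gamma_s
    the adjacency is b(x, y) = 0 with the value flipped between types (ii) and
    (iii).  Lines of the quadric meeting alpha_s are good, and through any z
    they cover at least the nonzero points other than z of the k-dimensional
    space <alpha_s cap z^perp, z>; hence d(z) >= 2^k - 2 for every z.

    Conversely let k >= 2 and let {x, y, z} be good with z of type (iii).  The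
    parity condition says that the linear form b(x + y + z, .) agrees on the
    quadric with a combination of the indicator functions of types (ii) and
    (iii).  Evaluating on suitable lines shows that this combination is zero,
    so x + y + z = 0 and the line meets alpha_s; hence d(z) <= 2^k - 2.

    For k = 1 the translation by the point of alpha_0 on the type (ii) points
    is an isomorphism from Gamma to Gamma_0, and in Gamma all lines of the
    quadric are good, so d(z) >= 2^(g+1) - 2 for every z.  The minima of d are
    therefore different for different s. *)
Require Import Defs.
From mathcomp Require Import all_boot all_order all_algebra.
From mathcomp Require Import ring.
Import GRing.Theory.
Set Implicit Arguments. Unset Strict Implicit. Unset Printing Implicit Defensive.
Local Open Scope ring_scope.

(** * Good triples of a graph and their invariance under isomorphism *)

Section GoodTriples.
Variables (T : finType) (P : {set T}).
Implicit Types (e : rel T) (x y z w : T).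

Definition nbr1 e x w := (x == w) || e x w.

Definition good e z y x :=
  [&& y \in P, x \in P, e z y, e z x, e y x &
      [forall w in P, nbr1 e z w (+) nbr1 e y w (+) nbr1 e x w]].

(** The cardinality of this set is the invariant $d(z)$. *)
Definition good_nbrs e z := [set y | [exists x, good e z y x]].

Lemma good_iso e1 e2 (f : T -> T) : {in P &, injective f} -> f @: P = P ->
  {in P &, forall x y, e1 x y = e2 (f x) (f y)} ->
  {in P & &, forall z y x, good e1 z y x = good e2 (f z) (f y) (f x)}.
Proof.
move=> injf fP ef z y x zP yP xP.
have fin v : v \in P -> f v \in P by move=> vP; rewrite -fP imset_f.
have nE : {in P &, forall v w, nbr1 e1 v w = nbr1 e2 (f v) (f w)}.
  by move=> v w vP wP; rewrite /nbr1 ef // (inj_in_eq injf).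
rewrite /good !fin // yP xP -!ef //; congr [&& _, _, _, _, _ & _].
apply/forall_inP/forall_inP => H w wP.
  move: wP; rewrite -{1}fP => /imsetP[v vP ->].
  by rewrite -!nE // H.
by rewrite !nE // H // fin.
Qed.

Lemma card_good_nbrs_iso e1 e2 (f : T -> T) z :
    {in P &, injective f} -> f @: P = P ->
    {in P &, forall x y, e1 x y = e2 (f x) (f y)} -> z \in P ->
  #|good_nbrs e2 (f z)| = #|good_nbrs e1 z|.
Proof.
move=> injf fP ef zP; have gE := good_iso injf fP ef.
have sub : {subset good_nbrs e1 z <= P}.
  by move=> y; rewrite inE => /existsP[x /and3P[]].
rewrite -(card_in_imset (sub_in2 sub injf)); apply: eq_card => y.
apply/idP/imsetP => [|[y' + ->]].
  rewrite inE => /existsP[x gx]; case/and3P: (gx).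
  rewrite -{1 2}fP => /imsetP[y' y'P Ey] /imsetP[x' x'P Ex] _.
  exists y' => //; rewrite inE; apply/existsP; exists x'.
  by rewrite gE // -Ey -Ex.
rewrite !inE => /existsP[x gx]; case/and3P: (gx) => y'P xP _.
by apply/existsP; exists (f x); rewrite -gE.
Qed.

Lemma good_nbrs_iso_ge e1 e2 m : graph_iso P e1 e2 ->
  {in P, forall z, m <= #|good_nbrs e1 z|}%N ->
  {in P, forall z, m <= #|good_nbrs e2 z|}%N.
Proof.
move=> [f [injf fP ef]] H z; rewrite -{1}fP => /imsetP[v vP ->].
by rewrite (card_good_nbrs_iso injf fP ef) // H.
Qed.

Lemma graph_iso_sym e1 e2 : graph_iso P e1 e2 -> graph_iso P e2 e1.
Proof.
move=> [f [injf fP ef]].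
(* Inverse of [f] on [P]; the default [y] is never met there, since [f] maps [P] onto [P]. *)
pose g y := odflt y [pick x in P | f x == y].
have gP y : y \in P -> g y \in P /\ f (g y) = y.
  rewrite -{1}fP => /imsetP[x xP ->]; rewrite /g.
  case: pickP => [x' /andP[x'P /eqP]|/(_ x)] //=.
  by rewrite xP eqxx.
have injg : {in P &, injective g}.
  by move=> x y /gP[_ {2}<-] /gP[_ {2}<-] ->.
exists g; split=> //.
  apply/eqP; rewrite eqEcard card_in_imset // leqnn andbT.
  by apply/subsetP => _ /imsetP[x /gP[? _] ->].
move=> x y /gP[gx Ex] /gP[gy Ey].
by rewrite ef // Ex Ey.
Qed.

End GoodTriples.

(** * The quadratic form and its polar form over $\mathbb F_2$ *)

Section Quadric.
Variables (n : nat) (A : 'M['F_2]_(n.+1)).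
Implicit Types (x y z u v w : vec n) (U W : 'M['F_2]_(n.+1)).

Lemma F2_cases (a : 'F_2) : a = 0 \/ a = 1.
Proof. by case: a => [[|[|]]] // i; [left | right]; apply: val_inj. Qed.

Lemma addF2_neq0 (a b : 'F_2) : (a + b != 0) = (a != 0) (+) (b != 0).
Proof. by case: (F2_cases a) => ->; case: (F2_cases b) => ->. Qed.

Lemma addvv x : x + x = 0.
Proof.
by apply/rowP => i; rewrite !mxE; case: (F2_cases (x 0 i)) => ->; apply: val_inj.
Qed.

Lemma addvK y x : x + y + y = x. Proof. by rewrite -addrA addvv addr0. Qed.

Lemma addv_eq0 x y : (x + y == 0) = (x == y).
Proof. by rewrite -(inj_eq (@addIr _ y)) addvK add0r. Qed.

(** Reading 1 as [true] turns addition in $\mathbb F_2$ into [(+)], so identities between values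
    reduce to boolean case analysis. *)
Definition q x : bool := qf A x != 0.
Definition b x y : bool := qb A x y != 0.

Lemma qbE x y : qb A x y = (x *m (A + A^T) *m y^T) 0 0.
Proof.
have D (M N : 'M['F_2]_1) : (M + N) 0 0 = M 0 0 + N 0 0 by rewrite mxE.
have Eyx : (y *m A *m x^T) 0 0 = (x *m A^T *m y^T) 0 0.
  have <- : (y *m A *m x^T)^T = x *m A^T *m y^T.
    by rewrite !trmx_mul trmxK mulmxA.
  by rewrite [RHS]mxE.
by rewrite /qb /qf linearD /= !mulmxDl !mulmxDr !mulmxDl !D Eyx; ring.
Qed.

Lemma qD x y : q (x + y) = q x (+) q y (+) b x y.
Proof.
rewrite /q /b; set c := qb A x y.
have -> : qf A (x + y) = qf A x + qf A y + c by rewrite /c /qb; ring.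
by rewrite !addF2_neq0.
Qed.

Lemma bDl x y z : b (x + y) z = b x z (+) b y z.
Proof. by rewrite /b !qbE !mulmxDl mxE addF2_neq0. Qed.

Lemma bC x y : b x y = b y x.
Proof. by rewrite /b /qb [y + x]addrC -!addrA [- qf A y - _]addrC. Qed.

Lemma bDr x y z : b x (y + z) = b x y (+) b x z.
Proof. by rewrite bC bDl !(bC x). Qed.

Lemma q0 : q 0 = false.
Proof. by rewrite /q /qf !mul0mx mxE eqxx. Qed.

Lemma bxx x : b x x = false.
Proof. by have := qD x x; rewrite addvv q0 addbb. Qed.

Lemma b0l x : b 0 x = false.
Proof. by have := bDl x x x; rewrite addvv addbb. Qed.

Lemma b0r x : b x 0 = false.
Proof. by rewrite bC b0l. Qed.

Lemma QptsE x : (x \in Qpts A) = (x != 0) && ~~ q x.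
Proof. by rewrite inE negbK. Qed.

Lemma adjE x y : x \in Qpts A -> y \in Qpts A ->
  adj A x y = (x != y) && ~~ b x y.
Proof.
move=> xQ yQ; rewrite /adj xQ yQ /=; congr (_ && _).
rewrite -[LHS]negbK -/(q (x + y)) qD.
by move: xQ yQ; rewrite !QptsE => /andP[_ /negbTE->] /andP[_ /negbTE->].
Qed.

Lemma tsing_q U v : tsing A U -> (v <= U)%MS -> q v = false.
Proof. by move=> tU vU; rewrite /q tU ?eqxx. Qed.

Lemma tsing_b U u v : tsing A U -> (u <= U)%MS -> (v <= U)%MS -> b u v = false.
Proof.
move=> tU uU vU; have := qD u v.
by rewrite !(tsing_q tU) ?addmx_sub.
Qed.

(** * Orthogonality and spans *)

Definition perp U x := [forall u : vec n, (u <= U)%MS ==> ~~ b u x].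

Lemma perpP U x :
  reflect (forall u, (u <= U)%MS -> b u x = false) (perp U x).
Proof.
apply: (iffP forallP) => H u; first by move=> uU; apply/negbTE/(implyP (H u)).
by apply/implyP => /H->.
Qed.

Lemma perpPn U x : reflect (exists2 u, (u <= U)%MS & b u x) (~~ perp U x).
Proof.
apply: (iffP idP) => [|[u uU bu]]; last by apply/perpP => /(_ u uU); rewrite bu.
by case/forallPn => u; rewrite negb_imply negbK => /andP[]; exists u.
Qed.

Lemma sub_vec_mx m (U : 'M['F_2]_(m, n.+1)) x v :
  (v <= U + x)%MS = (v <= U)%MS || ((v + x)%R <= U)%MS.
Proof.
apply/idP/orP.
  case/sub_addsmxP => [[c d] /= Ev].
  rewrite (mx11_scalar d) mul_scalar_mx in Ev.
  case: (F2_cases (d 0 0)) Ev => -> ->.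
    by left; rewrite scale0r addr0 submxMl.
  by right; rewrite scale1r addvK submxMl.
case=> vU; first exact: (submx_trans vU (addsmxSl _ _)).
rewrite -[v](addvK x) addmx_sub_adds //.
Qed.

(** Where $q$ vanishes on [U] and at [x], polarization gives $q(u+x)=b(u,x)$ for $u$ in [U]. *)
Lemma perp_tsing U x : tsing A U -> ~~ q x ->
  perp U x = [forall v : vec n, (v <= U + x)%MS ==> (qf A v == 0)].
Proof.
move=> tU /negbTE qx; apply/perpP/forallP => H v.
  apply/implyP; rewrite sub_vec_mx -[_ == 0]negbK -/(q v).
  case/orP=> [/(tsing_q tU)->//|vU].
  by rewrite -[v](addvK x) qD qx (tsing_q tU vU) (H _ vU).
move=> vU; have := H (v + x).
rewrite sub_vec_mx addvK vU orbT /= -[_ == 0]negbK -/(q _) qD qx.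
by rewrite (tsing_q tU vU) /= => /negbTE.
Qed.

Lemma card_submx m (U : 'M['F_2]_(m, n.+1)) :
  #|[set v : vec n | (v <= U)%MS]| = (2 ^ \rank U)%N.
Proof.
have inj : injective (mulmxr (row_base U) : 'rV_(\rank U) -> vec n).
  by apply: row_free_inj; apply: row_base_free.
have -> : [set v : vec n | (v <= U)%MS] =
          [set mulmxr (row_base U) c | c : 'rV_(\rank U)].
  apply/setP => v; rewrite inE -(eq_row_base U).
  by apply/submxP/imsetP => [[c ->]|[c _ ->]]; exists c.
by rewrite card_imset // card_mx card_Fp // mul1n.
Qed.

(** * Replacing a totally singular subspace by one through a given point *)

Section PencilThroughPoint.
Variables (U : 'M['F_2]_(n.+1)) (z : vec n).

(* The span of z and of the subspace of U orthogonal to z. *)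
Definition pencil : 'M['F_2]_(n.+1) :=
  ((U :&: kermx ((A + A^T) *m z^T)) + z)%MS.

Lemma sub_kerb v : (v <= kermx ((A + A^T) *m z^T))%MS = ~~ b v z.
Proof.
rewrite /b qbE -mulmxA negbK; apply/sub_kermxP/eqP => [->|H].
  by rewrite mxE.
by rewrite (mx11_scalar (v *m _)) H raddf0.
Qed.

Lemma sub_pencil v :
  (v <= pencil)%MS = ((v <= U)%MS || ((v + z)%R <= U)%MS) && ~~ b v z.
Proof. by rewrite /pencil sub_vec_mx !sub_capmx !sub_kerb bDl bxx addbF andb_orl. Qed.

Lemma sub_pencil_point : (z <= pencil)%MS.
Proof. exact: addsmxSr. Qed.

Lemma tsing_pencil : tsing A U -> ~~ q z -> tsing A pencil.
Proof.
move=> tU /negbTE qz v; rewrite sub_pencil => /andP[H /negbTE bvz].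
apply/eqP; rewrite -[_ == 0]negbK -/(q v).
case/orP: H => vU; first by rewrite (tsing_q tU).
by rewrite -[v](addvK z) qD qz (tsing_q tU vU) bDl bvz bxx.
Qed.

(** Cutting [U] by the hyperplane $z^\perp$ costs at most one dimension, and adjoining a [z] outside
    [U] restores it. *)
Lemma rank_pencil_ge : tsing A U -> (\rank U <= \rank pencil)%N.
Proof.
move=> tU; have [zU|zU] := boolP (z <= U)%MS.
  apply: mxrankS; apply/rV_subP => v vU.
  by rewrite sub_pencil vU (tsing_b tU vU zU).
rewrite -(mxrank_mul_ker U ((A + A^T) *m z^T)) /pencil.
set K := kermx _.
have := mxrank_sum_cap (U :&: K)%MS z.
have -> : \rank (U :&: K :&: z)%MS = 0%N.
  apply/eqP; rewrite mxrank_eq0; apply/eqP/row_matrixP => i; rewrite row0.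
  have := row_sub i (U :&: K :&: z)%MS; rewrite !sub_capmx => /andP[/andP[rU _]].
  case/sub_rVP => a Ea; case: (F2_cases a) Ea rU => -> -> //.
    by rewrite scale0r.
  by rewrite scale1r (negPf zU).
have -> : \rank z = 1%N.
  by rewrite rank_rV; case: eqP zU => // ->; rewrite sub0mx.
rewrite addn0 => ->; rewrite addnC leq_add2l; exact: rank_leq_col.
Qed.

(** Here $z^\perp$ does not contain [U], so the cut really loses a dimension and [z] can at most
    restore it. *)
Lemma rank_pencil_le : ~~ perp U z -> (\rank pencil <= \rank U)%N.
Proof.
case/perpPn => u uU buz.
rewrite -(mxrank_mul_ker U ((A + A^T) *m z^T)) addnC /pencil.
apply: leq_trans (mxrank_adds_leqif _ _) _; rewrite leq_add2l.
apply: leq_trans (rank_leq_row _) _.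
rewrite lt0n mxrank_eq0; apply: contraL buz => /eqP U0.
by rewrite -sub_kerb; apply: submx_trans uU _; apply/sub_kermxP.
Qed.

End PencilThroughPoint.

(** The rows of [U] are absorbed into [W0] one at a time by pencils. Rows already absorbed survive
    because the rows of [U] are mutually orthogonal. *)
Lemma tsing_extend U W0 : tsing A U -> tsing A W0 ->
  exists W, [/\ tsing A W, (U <= W)%MS & (\rank W0 <= \rank W)%N].
Proof.
move=> tU tW0.
have H m : (m <= n.+1)%N -> exists W, [/\ tsing A W,
   forall i : 'I_n.+1, (i < m)%N -> (row i U <= W)%MS & (\rank W0 <= \rank W)%N].
  elim: m => [|m IHm] lem; first by exists W0.
  have [W [tW sW rW]] := IHm (ltnW lem); pose z := row (Ordinal lem) U.
  have qz : ~~ q z by rewrite (tsing_q tU) ?row_sub.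
  exists (pencil W z); split; first exact: tsing_pencil.
    move=> i; rewrite ltnS leq_eqVlt => /orP[/eqP im|im].
      by have -> : i = Ordinal lem; [apply: val_inj | apply: sub_pencil_point].
    by rewrite sub_pencil sW // (tsing_b tU) ?row_sub.
  by apply: leq_trans rW (rank_pencil_ge _ tW).
have [W [tW sW rW]] := H _ (leqnn _).
by exists W; split=> //; apply/row_subP => i; apply: sW.
Qed.

(** * The three types of points and the effect of switching *)

(** For totally singular [U] these are the type (iii) points: points of [U] are orthogonal to [U],
    so types (i) and (ii) are both excluded. *)
Definition Zs U : {set vec n} := [set x in Qpts A | ~~ perp U x].

Lemma XsE U x : tsing A U ->
  (x \in Xs A U) = [&& x \in Qpts A, ~~ (x <= U)%MS & perp U x].
Proof.
move=> tU; rewrite inE; case xQ: (x \in Qpts A) => //=.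
by rewrite perp_tsing //; move: xQ; rewrite QptsE => /andP[].
Qed.

Lemma ZsE U x : (x \in Zs U) = (x \in Qpts A) && ~~ perp U x.
Proof. by rewrite inE. Qed.

Lemma Xs_neq0 U g : proj_index A g -> tsing A U -> (\rank U <= g)%N ->
  Xs A U != set0.
Proof.
move=> [[W0 [rW0 tW0]] _] tU rU.
have [W [tW UW rW]] := tsing_extend tU tW0.
have /row_subPn[i niU] : ~~ (W <= U)%MS.
  by apply: contraL rW => /mxrankS rWU; rewrite rW0 -ltnNge ltnS (leq_trans rWU).
apply/set0Pn; exists (row i W); rewrite XsE // niU QptsE.
rewrite (tsing_q tW) ?row_sub //=.
rewrite andbT; apply/andP; split; first by apply: contraNneq niU => ->; rewrite sub0mx.
by apply/perpP => u uU; rewrite (tsing_b tW) ?row_sub // (submx_trans uU).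
Qed.

Lemma perpD U x y : perp U y -> perp U (x + y) = perp U x.
Proof.
move=> /perpP Uy; apply: eq_forallb => u.
by case uU: (u <= U)%MS; rewrite //= bDr Uy ?addbF.
Qed.

Lemma perp_sub U u : tsing A U -> (u <= U)%MS -> perp U u.
Proof. by move=> tU uU; apply/perpP => v vU; apply: (tsing_b tU). Qed.

Lemma submxD U x u : (u <= U)%MS -> ((x + u)%R <= U)%MS = (x <= U)%MS.
Proof.
move=> uU; apply/idP/idP => H; last exact: addmx_sub.
by rewrite -[x](addvK u) addmx_sub.
Qed.

Lemma Xs_addU U x u : tsing A U -> (u <= U)%MS -> x \in Xs A U -> x + u \in Xs A U.
Proof.
move=> tU uU; rewrite !XsE // submxD // (perpD _ (perp_sub tU uU)) !QptsE.
case/and3P => /andP[x0 /negbTE qx] xU px; rewrite xU px !andbT.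
rewrite qD qx (tsing_q tU uU) bC (perpP _ _ px) // andbT addv_eq0.
by apply: contraNneq xU => ->.
Qed.

Lemma Xs_Zs U x : tsing A U -> x \in Xs A U -> x \notin Zs U.
Proof. by move=> tU; rewrite XsE // ZsE => /and3P[-> _ ->]. Qed.

Lemma type_i U x : tsing A U -> x \in Qpts A -> x \notin Xs A U ->
  x \notin Zs U -> (x <= U)%MS.
Proof.
move=> tU xQ; rewrite XsE // ZsE xQ /= negbK => + px.
by rewrite px andbT negbK.
Qed.

Lemma sub_notin_Xs U x : tsing A U -> (x <= U)%MS -> (x \in Xs A U) = false.
Proof. by move=> tU xU; rewrite XsE // xU andbF. Qed.

Lemma sub_notin_Zs U x : tsing A U -> (x <= U)%MS -> (x \in Zs U) = false.
Proof. by move=> tU xU; rewrite ZsE perp_sub ?andbF. Qed.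

(** If $b(u,r)=1$ with $u$ in [U], translation by $u$ permutes the type (ii) points and exchanges
    neighbours and non-neighbours of [r], so each make up half. A type (i) point is adjacent to all
    type (ii) points, of which there is at least one. *)
Lemma switchedE U r : tsing A U -> Xs A U != set0 -> r \in Qpts A ->
  switched A U r = (r \in Zs U).
Proof.
move=> tU X0 rQ; rewrite /switched in_setD rQ andbT.
have XQ x : x \in Xs A U -> x \in Qpts A by rewrite inE => /andP[].
case rZ: (r \in Zs U).
  have rX : r \notin Xs A U by apply/negP => /(Xs_Zs tU); rewrite rZ.
  rewrite rX /=.
  have /perpPn[u uU bur] : ~~ perp U r by move: rZ; rewrite ZsE => /andP[].
  set S := [set x in _ | _].
  have adjX x : x \in Xs A U -> adj A r x = ~~ b r x.
    move=> xX; rewrite (adjE rQ (XQ _ xX)); have [Erx|//] := eqVneq r x.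
    by rewrite -Erx (negPf rX) in xX.
  have SE x : (x \in S) = (x \in Xs A U) && adj A r x by rewrite /S in_set.
  have -> : Xs A U = S :|: [set x + u | x in S].
    apply/setP => x; rewrite in_setU.
    apply/idP/orP => [xX|[|/imsetP[y + ->]]]; rewrite SE; last first.
    - by case/andP => yX _; apply: Xs_addU.
    - by case/andP.
    rewrite xX /= adjX //; case brx: (b r x); [right | by left].
    apply/imsetP; exists (x + u); last by rewrite addvK.
    by rewrite SE Xs_addU //= adjX ?Xs_addU // bDr brx bC bur.
  have injS : injective (fun x : vec n => x + u) by exact: addIr.
  have : [disjoint S & [set x + u | x in S]].
    apply/pred0P => x /=; apply/negP => /andP[+ /imsetP[y + Ex]].
    rewrite !SE => /andP[xX + /andP[yX]]; rewrite !adjX // Ex bDr (bC r u) bur.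
    by case: (b r y).
  by rewrite -(leq_card_setU _ _).2 => /eqP->;
    rewrite (card_imset _ injS) mul2n addnn eqxx.
apply/negbTE/negP => /andP[rX]; have rU := type_i tU rQ rX (negbT rZ).
have -> : [set x in Xs A U | adj A r x] = Xs A U.
  apply/setP => x; rewrite in_set; case xX: (x \in _) => //=.
  rewrite (adjE rQ (XQ _ xX)); move: xX; rewrite XsE // => /and3P[_ xU /perpP->//].
  by rewrite andbT; apply: contraNneq xU => <-.
rewrite mul2n -addnn -[X in _ == X]addn0 eqn_add2l cards_eq0.
exact/negP.
Qed.

Definition twist U x y :=
  (x \in Xs A U) && (y \in Zs U) (+) (y \in Xs A U) && (x \in Zs U).

Lemma adjSE U x y : tsing A U -> Xs A U != set0 -> x \in Qpts A -> y \in Qpts A ->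
  adjS A U x y = (x != y) && ~~ (b x y (+) twist U x y).
Proof.
move=> tU X0 xQ yQ; rewrite /adjS !switchedE // !in_setD xQ yQ !adjE // !andbT /twist.
have XZ v : v \in Xs A U -> v \in Zs U = false by move=> /(Xs_Zs tU)/negbTE.
have [Exy|nxy] := eqVneq x y.
  by rewrite Exy; case: (y \in Xs A U); rewrite //= andbF.
case xX: (x \in Xs A U); case yX: (y \in Xs A U); rewrite ?(XZ _ xX) ?(XZ _ yX) //=;
  do ?[by case: (b x y); case: (_ \in Zs U)].
Qed.

(** Both $b$ and [twist] vanish on the diagonal, so the reflexive closure obeys one formula without
    exception. *)
Lemma nbr1_adjS U x y : tsing A U -> Xs A U != set0 -> x \in Qpts A -> y \in Qpts A ->
  nbr1 (adjS A U) x y = ~~ (b x y (+) twist U x y).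
Proof.
move=> tU X0 xQ yQ; rewrite /nbr1 adjSE //.
have [-> /=|//] := eqVneq x y.
by rewrite bxx /twist addbb.
Qed.

(** * Lower bounds for the number of good neighbours *)

Lemma tsing_Qpts W v : tsing A W -> (v <= W)%MS -> v != 0 -> v \in Qpts A.
Proof. by move=> tW vW v0; rewrite QptsE v0 (tsing_q tW vW). Qed.

Lemma card_good_nbrs_ge e W z : (z <= W)%MS ->
  (forall y, (y <= W)%MS -> y != 0 -> y != z -> good (Qpts A) e z y (y + z)) ->
  (2 ^ \rank W - 2 <= #|good_nbrs (Qpts A) e z|)%N.
Proof.
move=> zW H; rewrite -card_submx; set S := [set v | _].
have sub : S :\ 0 :\ z \subset good_nbrs (Qpts A) e z.
  apply/subsetP => y; rewrite !inE => /and3P[yz y0 yW].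
  by apply/existsP; exists (y + z); apply: H.
apply: leq_trans (subset_leq_card sub).
(* The 2 accounts for the vectors 0 and [z], each removed at most once. *)
rewrite leq_subLR (cardsD1 0 S) (cardsD1 z (S :\ 0)) addnA leq_add2r.
exact: (leq_add (leq_b1 _) (leq_b1 _)).
Qed.

Lemma Qpts_add x y : x \in Qpts A -> y \in Qpts A -> x != y -> b x y = false ->
  x + y \in Qpts A.
Proof.
rewrite !QptsE => /andP[_ /negbTE qx] /andP[_ /negbTE qy] nxy bxy.
by rewrite addv_eq0 nxy qD qx qy bxy.
Qed.

(** As [y] or [y + z] lies in [U], the other two points of the line have equal type. Hence the
    indicators of types (ii) and (iii), like $b(\cdot,w)$, sum to zero along the line. *)
Lemma good_line U z y : tsing A U -> Xs A U != set0 -> z \in Qpts A ->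
  y \in Qpts A -> y != z -> b y z = false ->
  (y <= U)%MS || ((y + z)%R <= U)%MS ->
  good (Qpts A) (adjS A U) z y (y + z).
Proof.
move=> tU X0 zQ yQ yz byz H.
have xQ := Qpts_add yQ zQ yz byz.
have y0 : y != 0 by move: yQ; rewrite QptsE => /andP[].
have z0 : z != 0 by move: zQ; rewrite QptsE => /andP[].
have Xx : (y + z \in Xs A U) = (y \in Xs A U) (+) (z \in Xs A U).
  case/orP: H => H.
    rewrite (sub_notin_Xs tU H) /= addrC !XsE // submxD //.
    by rewrite (perpD _ (perp_sub tU H)) [z + y]addrC xQ zQ.
  rewrite (sub_notin_Xs tU H) !XsE // -(submxD z H) -(perpD z (perp_sub tU H)).
  by rewrite [y + z]addrC addrA addvv add0r yQ zQ addbb.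
have Zx : (y + z \in Zs U) = (y \in Zs U) (+) (z \in Zs U).
  case/orP: H => H.
    rewrite (sub_notin_Zs tU H) /= addrC !ZsE.
    by rewrite (perpD _ (perp_sub tU H)) [z + y]addrC xQ zQ.
  rewrite (sub_notin_Zs tU H) !ZsE -(perpD z (perp_sub tU H)).
  by rewrite [y + z]addrC addrA addvv add0r yQ zQ addbb.
have tyz : twist U z y = false.
  rewrite /twist; case/orP: H => H.
    by rewrite (sub_notin_Xs tU H) (sub_notin_Zs tU H) !andbF.
  move: Xx Zx; rewrite (sub_notin_Xs tU H) (sub_notin_Zs tU H).
  by do 4 case: (_ \in _).
rewrite /good yQ xQ !adjSE // eq_sym yz tyz bC byz /=.
have nzx : z != y + z by rewrite -(inj_eq (@addIr _ z)) addvv addvK eq_sym.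
have nyx : y != y + z by rewrite -addv_eq0 addrA addvv add0r.
have tzx : twist U z (y + z) = false.
  move: tyz; rewrite /twist Xx Zx.
  by do 4 case: (_ \in _).
have tyx : twist U y (y + z) = false.
  move: tyz; rewrite /twist Xx Zx.
  by do 4 case: (_ \in _).
rewrite nzx nyx tzx tyx !bDr !bxx bC byz /=.
apply/forall_inP => w wQ; rewrite !nbr1_adjS // bDl /twist Xx Zx.
by case: (b z w); case: (b y w); do 6 case: (_ \in _).
Qed.

Lemma card_good_nbrs_adjS U z : tsing A U -> Xs A U != set0 -> z \in Qpts A ->
  (2 ^ \rank U - 2 <= #|good_nbrs (Qpts A) (adjS A U) z|)%N.
Proof.
move=> tU X0 zQ; have qz : ~~ q z by move: zQ; rewrite QptsE => /andP[].
apply: leq_trans (card_good_nbrs_ge (sub_pencil_point U z) _).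
  by rewrite leq_sub2r // leq_exp2l // rank_pencil_ge.
move=> y yW y0 yz; move: (yW); rewrite sub_pencil => /andP[yU /negbTE byz].
by apply: good_line => //; apply: tsing_Qpts yW y0; apply: tsing_pencil.
Qed.

Lemma good_adj z y : z \in Qpts A -> y \in Qpts A -> y != z -> b y z = false ->
  good (Qpts A) (adj A) z y (y + z).
Proof.
move=> zQ yQ yz byz.
have xQ := Qpts_add yQ zQ yz byz.
have y0 : y != 0 by move: yQ; rewrite QptsE => /andP[].
have z0 : z != 0 by move: zQ; rewrite QptsE => /andP[].
have nzx : z != y + z by rewrite -(inj_eq (@addIr _ z)) addvv addvK eq_sym.
have nyx : y != y + z by rewrite -addv_eq0 addrA addvv add0r.
rewrite /good yQ xQ !adjE // eq_sym yz nzx nyx !bDr !bxx (bC z y) byz /=.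
apply/forall_inP => w wQ.
have nE v : v \in Qpts A -> nbr1 (adj A) v w = ~~ b v w.
  by move=> vQ; rewrite /nbr1 adjE //; have [->|] := eqVneq v w; rewrite ?bxx.
by rewrite !nE // bDl; case: (b z w); case: (b y w).
Qed.

(** The pencil of [z] and a maximal subspace is a totally singular subspace through [z] of rank at
    least $g+1$, and all its lines through [z] are good. *)
Lemma card_good_nbrs_adj g z : proj_index A g -> z \in Qpts A ->
  (2 ^ g.+1 - 2 <= #|good_nbrs (Qpts A) (adj A) z|)%N.
Proof.
move=> [[W0 [rW0 tW0]] _] zQ; have qz : ~~ q z by move: zQ; rewrite QptsE => /andP[].
apply: leq_trans (card_good_nbrs_ge (sub_pencil_point W0 z) _).
  by rewrite leq_sub2r // leq_exp2l // -rW0 rank_pencil_ge.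
move=> y yW y0 yz.
apply: good_adj => //; last by move: yW; rewrite sub_pencil => /andP[_ /negbTE].
by apply: tsing_Qpts yW y0; apply: tsing_pencil.
Qed.

(** * The case where the subspace is a single point *)

(** Let [u] be the point of [U]. Adding [u] to a type (ii) point [x] changes $b(x,y)$ by $b(u,y)$,
    which is 1 exactly for [y] of type (iii). *)
Lemma adj_iso_adjS1 U : tsing A U -> Xs A U != set0 -> \rank U = 1%N ->
  graph_iso (Qpts A) (adj A) (adjS A U).
Proof.
move=> tU X0 rU; pose u := nz_row U.
have uU : (u <= U)%MS by apply: nz_row_sub.
have u0 : u != 0 by rewrite nz_row_eq0 -mxrank_eq0 rU.
have Uu : (U <= u)%MS.
  by have := mxrank_leqif_sup uU; rewrite rU rank_rV u0 => -[_ /esym/eqP/eqP].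
have pE x : perp U x = ~~ b u x.
  apply/perpP/idP => [->|/negbTE bux v vU] //.
  have /sub_rVP[a ->] := submx_trans vU Uu.
  by case: (F2_cases a) => ->; rewrite ?scale0r ?b0l // scale1r.
pose f x := if x \in Xs A U then x + u else x.
have fX x : (f x \in Xs A U) = (x \in Xs A U).
  by rewrite /f; case xX: (x \in Xs A U); rewrite ?Xs_addU.
have fK : involutive f.
  by move=> x; have := fX x; rewrite /f; case xX: (x \in _) => H; rewrite H ?addvK.
have fQ x : x \in Qpts A -> f x \in Qpts A.
  rewrite /f; case: ifP => // /(Xs_addU tU uU).
  by rewrite inE => /andP[].
have XbE x : x \in Xs A U -> b u x = false.
  by rewrite XsE // pE => /and3P[_ _ /negbTE].
exists f; split; first by move=> x y _ _; apply: (can_inj fK).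
  apply/eqP; rewrite eqEcard card_imset ?leqnn; last exact: can_inj fK.
  by rewrite andbT; apply/subsetP => _ /imsetP[x /fQ + ->].
move=> x y xQ yQ; rewrite adjE // adjSE ?fQ // (inj_eq (can_inj fK)).
congr (_ && ~~ _).
rewrite /twist !fX !ZsE !fQ // !pE !negbK /f.
case xX: (x \in Xs A U); case yX: (y \in Xs A U);
  by rewrite ?bDl ?bDr ?bxx ?[b _ u]bC ?(XbE _ xX) ?(XbE _ yX)
             ?addbF //= ?addbK ?addbA ?addbK // addbC addbK.
Qed.

(** * The upper bound at type (iii) points *)

Lemma sing_partner u : nonsingular A -> u != 0 -> q u = false ->
  exists w, b u w.
Proof.
move=> ns u0 qu; apply/existsP; apply: contraNT u0.
rewrite negb_exists => /forallP H; apply/eqP/ns.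
  by apply/eqP; rewrite -[_ == 0]negbK -/(q u) qu.
by move=> w; have := H w; rewrite negbK => /eqP.
Qed.

(* Translating by the singular vector u changes q w when b u w = 1. *)
Lemma sing_translate u w : q u = false -> b u w ->
  exists w', [/\ w' \in Qpts A, b u w' & w' = w \/ w' = w + u].
Proof.
move=> qu buw.
have b_neq0 v : b u v -> v != 0 by apply: contraTneq => ->; rewrite b0r.
case qw: (q w); last by exists w; split; [rewrite QptsE b_neq0 ?qw | | left].
have buw' : b u (w + u) by rewrite bDr bxx buw.
exists (w + u); split; [|by []|by right].
by rewrite QptsE b_neq0 // qD qu qw bC buw.
Qed.

Lemma Zs_neq0 U : nonsingular A -> tsing A U -> \rank U != 0%N -> Zs U != set0.
Proof.
move=> ns tU; rewrite mxrank_eq0 -nz_row_eq0; set u := nz_row U => u0.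
have uU : (u <= U)%MS by apply: nz_row_sub.
have qu := tsing_q tU uU.
have [w0 /(sing_translate qu)[w [wQ buw _]]] := sing_partner ns u0 qu.
apply/set0Pn; exists w; rewrite ZsE wQ; apply/perpPn.
by exists u.
Qed.

(** A nonzero [x] would have a non-orthogonal partner, which can be moved onto the quadric by adding
    [x]. *)
Lemma Qpts_orth_eq0 x : nonsingular A -> q x = false ->
  {in Qpts A, forall w, b x w = false} -> x = 0.
Proof.
move=> ns qx H; apply/eqP; apply: contraT => x0.
have [w0 /(sing_translate qx)[w [wQ bxw _]]] := sing_partner ns x0 qx.
by rewrite H in bxw.
Qed.

(** The form $b(v,\cdot)$ sums to zero on each line of the quadric. A line of types (iii), (iii),
    (iii) has sum [a], and one of types (iii), (ii), (iii) has sum [c]. *)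
Lemma linear_type_coefs U v (a c : bool) :
    nonsingular A -> tsing A U -> Xs A U != set0 -> (1 < \rank U)%N ->
    {in Qpts A, forall w, b v w = a && (w \in Zs U) (+) c && (w \in Xs A U)} ->
  a = false /\ c = false.
Proof.
move=> ns tU X0 rU H.
have /set0Pn[z zZ] : Zs U != set0 by apply: Zs_neq0 => //; rewrite -lt0n ltnW.
have := zZ; rewrite ZsE => /andP[zQ /perpPn[u1 u1U bu1]].
have ZX p : p \in Zs U -> p \in Xs A U = false.
  by move=> pZ; apply/negP => /(Xs_Zs tU); rewrite pZ.
split; apply/negbTE/negP => ac.
  have /row_subPn[i niU] : ~~ (U <= u1)%MS.
    apply: contraL rU => /mxrankS rUu; rewrite -leqNgt.
    by apply: leq_trans rUu (rank_leq_row _).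
  set u0 := row i U in niU; have u0U : (u0 <= U)%MS by apply: row_sub.
  (* A line whose three points are z, w2, z + w2, all of type (iii): the
     vector u of U is orthogonal to z but not to w2. *)
  pose u := if b u0 z then u0 + u1 else u0.
  have uU : (u <= U)%MS by rewrite /u; case: ifP => // _; apply: addmx_sub.
  have n0 : u != 0.
    rewrite /u; case: ifP => _; first rewrite addv_eq0.
      by apply: contraNneq niU => ->.
    by apply: contraNneq niU => ->; rewrite sub0mx.
  have buz : b u z = false by rewrite /u; case: ifP => //; rewrite bDl bu1 => ->.
  have qu := tsing_q tU uU.
  have [w bw] := sing_partner ns n0 qu.
  (* Adding [u1] flips $b(z,\cdot)$ and leaves $b(u,\cdot)$ unchanged. *)
  have [w1 bw1 bzw1] : exists2 w1, b u w1 & b z w1 = false.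
    case bzw: (b z w); last by exists w.
    exists (w + u1); first by rewrite bDr bw (tsing_b tU).
    by rewrite bDr bzw bC bu1.
  have [w2 [w2Q bw2 Ew2]] := sing_translate qu bw1.
  have bzw2 : b z w2 = false by case: Ew2 => ->; rewrite ?bDr bzw1 // bC.
  have Zmem p : p \in Qpts A -> b u p -> p \in Zs U.
    by move=> pQ bp; rewrite ZsE pQ; apply/perpPn; exists u.
  have nzw : z != w2 by apply: contraTneq bw2 => <-; rewrite buz.
  have z3Q := Qpts_add zQ w2Q nzw bzw2.
  have z3Z : z + w2 \in Zs U by apply: Zmem; rewrite // bDr buz.
  have w2Z := Zmem _ w2Q bw2.
  have := bDr v z w2; rewrite !H // !ZX // zZ w2Z z3Z ac.
  by case: (c).
(* For [c], a type (ii) point orthogonal to [z] is obtained by translating by [u1] if necessary. *)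
have [x xX bzx] : exists2 x, x \in Xs A U & b z x = false.
  have /set0Pn[x xX] := X0.
  case bzx: (b z x); last by exists x.
  by exists (x + u1); [apply: Xs_addU | rewrite bDr bzx bC bu1].
have := xX; rewrite XsE // => /and3P[xQ xU px].
have nzx : z != x by apply: contraTneq zZ => ->; apply: Xs_Zs.
have yQ := Qpts_add zQ xQ nzx bzx.
have yZ : z + x \in Zs U by rewrite ZsE yQ perpD //; move: zZ; rewrite ZsE => /andP[].
have xZ := Xs_Zs tU xX.
have := bDr v z x; rewrite !H // (ZX _ zZ) (ZX _ yZ) zZ yZ xX (negPf xZ) ac.
by case: (a).
Qed.

Lemma good_Zs U z y x : nonsingular A -> tsing A U -> Xs A U != set0 ->
  (1 < \rank U)%N -> z \in Zs U -> good (Qpts A) (adjS A U) z y x ->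
  (y <= pencil U z)%MS.
Proof.
move=> ns tU X0 rU zZ /and5P[yQ xQ + + /andP[+ /forall_inP par]].
have zQ : z \in Qpts A by move: zZ; rewrite ZsE => /andP[].
rewrite !adjSE // => /andP[nzy ezy] /andP[nzx ezx] /andP[nyx eyx].
have ZX p : p \in Zs U -> p \in Xs A U = false.
  by move=> pZ; apply/negP => /(Xs_Zs tU); rewrite pZ.
have XZ p : p \in Xs A U -> p \in Zs U = false.
  by move=> pZ; apply/negP => /ZX; rewrite pZ.
(* Summing the twists over the triple, [w] of type (iii) meets its type (ii) members and [w] of type
   (ii) its type (iii) members. The negation in [c] counts [z] itself. *)
pose a := (y \in Xs A U) (+) (x \in Xs A U).
pose c := ~~ ((y \in Zs U) (+) (x \in Zs U)).
have [] := @linear_type_coefs U (z + y + x) a c ns tU X0 rU.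
  move=> w wQ; have := par w wQ; rewrite !nbr1_adjS // !bDl /twist /a /c zZ (ZX _ zZ).
  case: (b z w); case: (b y w); case: (b x w);
  case: (w \in Xs A U); case: (w \in Zs U);
  case: (y \in Xs A U); case: (y \in Zs U);
  case: (x \in Xs A U); case: (x \in Zs U); by [].
rewrite /a /c => Ea Ec.
(* [c] = 0 makes exactly one of [y], [x] type (iii); then [a] = 0 keeps the other from being type
   (ii), so it lies in [U]. *)
have [[yZ xU]|[xZ yU]] : (y \in Zs U /\ (x <= U)%MS) \/ (x \in Zs U /\ (y <= U)%MS).
- case yZ: (y \in Zs U) Ea Ec; case xZ: (x \in Zs U) => // + _.
    rewrite (ZX _ yZ) /= => xX; left; split=> //.
    by apply: type_i; rewrite ?xX ?xZ.
  rewrite (ZX _ xZ) addbF => yX; right; split=> //.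
  by apply: type_i; rewrite ?yX ?yZ.
- have bzy : b z y = false.
    by move: ezy; rewrite /twist zZ yZ !ZX // addbF => /negbTE.
  have bzx : b z x = false.
    by move: ezx; rewrite /twist (sub_notin_Xs tU xU) (sub_notin_Zs tU xU) andbF addbF;
      move/negbTE.
  have byx : b y x = false.
    by move: eyx; rewrite /twist (sub_notin_Xs tU xU) (sub_notin_Zs tU xU) andbF addbF;
      move/negbTE.
  have /eqP : z + y + x = 0.
    apply: Qpts_orth_eq0 => //.
      by move: zQ yQ xQ; rewrite !QptsE !qD bDl bzy bzx byx;
        do 3 case/andP=> _ /negbTE->.
    move=> w wQ; have := par w wQ; rewrite !nbr1_adjS // !bDl /twist.
    rewrite yZ zZ (ZX _ yZ) (ZX _ zZ) (sub_notin_Xs tU xU) (sub_notin_Zs tU xU) /=.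
    by case: (b z w); case: (b y w); case: (b x w); case: (w \in Xs A U).
  by rewrite addv_eq0 sub_pencil [b y z]bC bzy addrC andbT => /eqP->; rewrite xU orbT.
(* When [y] lies in [U], adjacency to [z] means orthogonality, which already puts [y] in the
   pencil. *)
have bzy : b z y = false.
  by move: ezy; rewrite /twist (sub_notin_Xs tU yU) (sub_notin_Zs tU yU) andbF addbF;
      move/negbTE.
by rewrite sub_pencil yU bC bzy.
Qed.

Lemma card_good_nbrs_Zs U z : nonsingular A -> tsing A U -> Xs A U != set0 ->
  (1 < \rank U)%N -> z \in Zs U ->
  (#|good_nbrs (Qpts A) (adjS A U) z| <= 2 ^ \rank U - 2)%N.
Proof.
move=> ns tU X0 rU zZ; set S := [set v : vec n | (v <= pencil U z)%MS].
have [zQ pz] : z \in Qpts A /\ ~~ perp U z by move: zZ; rewrite ZsE => /andP.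
have z0 : z != 0 by move: zQ; rewrite QptsE => /andP[].
have sub : good_nbrs (Qpts A) (adjS A U) z \subset S :\ 0 :\ z.
  apply/subsetP => y; rewrite in_set => /existsP[x gx].
  have yW := good_Zs ns tU X0 rU zZ gx.
  move: gx => /and3P[yQ _ /andP[]]; rewrite adjSE // => /andP[nzy _] _.
  rewrite !in_setD1 in_set yW eq_sym nzy.
  by move: yQ; rewrite QptsE => /andP[->].
apply: leq_trans (subset_leq_card sub) _.
apply: (@leq_trans (#|S| - 2)); last first.
  by rewrite card_submx leq_sub2r // leq_exp2l // rank_pencil_le.
rewrite (cardsD1 0 S) (cardsD1 z (S :\ 0)) in_setD1 z0 !in_set.
by rewrite sub0mx sub_pencil_point addnA addKn.
Qed.

(** * Comparing the invariants for two ranks *)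

Lemma not_iso_adjS_lt U W g : nonsingular A -> proj_index A g ->
  tsing A U -> tsing A W -> (0 < \rank U)%N ->
  (\rank U <= g)%N -> (\rank W <= g)%N -> (\rank U < \rank W)%N ->
  ~ graph_iso (Qpts A) (adjS A U) (adjS A W).
Proof.
move=> ns pg tU tW rU0 rUg rWg rUW iso; have rW0 := ltn_trans rU0 rUW.
have UX := Xs_neq0 pg tU rUg; have WX := Xs_neq0 pg tW rWg.
(* Positivity of [i] matters: with truncated subtraction the exponents 0 and 1 both give 0. *)
have exp_lt i j : (0 < i)%N -> (i < j)%N -> (2 ^ i - 2 < 2 ^ j - 2)%N.
  move=> i0 ij; rewrite ltn_sub2rE ?ltn_exp2l //.
  by rewrite -[X in (X <= _)%N](expn1 2) leq_exp2l.
(* In rank 1 the bound $2^{g+1}-2$ passes from $\Gamma$ through the graph of [U] to that of [W],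
   where a type (iii) point violates it because [W] has rank at most $g$. *)
have [rU1|rU1] := leqP (\rank U) 1.
  have rUE : \rank U = 1%N by apply/eqP; rewrite eqn_leq rU1.
  have /set0Pn[z zZ] := Zs_neq0 ns tW (lt0n_neq0 rW0).
  have zQ : z \in Qpts A by move: zZ; rewrite ZsE => /andP[].
  have := good_nbrs_iso_ge iso (good_nbrs_iso_ge (adj_iso_adjS1 tU UX rUE)
    (fun z => @card_good_nbrs_adj g z pg)) zQ.
  rewrite leqNgt => /negP; apply.
  apply: leq_ltn_trans (card_good_nbrs_Zs ns tW WX _ zZ) _.
    exact: leq_ltn_trans rUW.
  exact: exp_lt.
(* In higher rank the lower bound for [W] is carried back to the graph of [U] and fails at a type
   (iii) point. *)
have /set0Pn[z zZ] := Zs_neq0 ns tU (lt0n_neq0 rU0).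
have zQ : z \in Qpts A by move: zZ; rewrite ZsE => /andP[].
have := good_nbrs_iso_ge (graph_iso_sym iso)
  (fun z => @card_good_nbrs_adjS W z tW WX) zQ.
rewrite leqNgt => /negP; apply.
exact: leq_ltn_trans (card_good_nbrs_Zs ns tU UX rU1 zZ) (exp_lt _ _ rU0 rUW).
Qed.

End Quadric.

Theorem theorem6p2 (n g : nat) (A : 'M['F_2]_(n.+1))
    (alpha : nat -> 'M['F_2]_(n.+1)) :
  nonsingular A -> proj_index A g -> (1 <= g)%N ->
  (forall s, (s < g)%N -> \rank (alpha s) = s.+1 /\ tsing A (alpha s)) ->
  forall s t, (s < g)%N -> (t < g)%N -> s <> t ->
  ~ graph_iso (Qpts A) (adjS A (alpha s)) (adjS A (alpha t)).
Proof.
move=> ns pg _ Ha s t sg tg /eqP; rewrite neq_ltn => /orP[] st iso.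
  have [rs ts] := Ha s sg; have [rt tt] := Ha t tg.
  by apply: (not_iso_adjS_lt ns pg ts tt _ _ _ _ iso); rewrite ?rs ?rt.
have [rs ts] := Ha s sg; have [rt tt] := Ha t tg.
by apply: (not_iso_adjS_lt ns pg tt ts _ _ _ _ (graph_iso_sym iso)); rewrite ?rs ?rt.
Qed.
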